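(* Let $(X,f)$ be a topological dynamical system, let $Z\subset X$ be an arbitrary subset, and let $\varphi:X\to\mathbb{R}$ be a continuous function. Then the Pesin pressure of $\varphi$ on $Z$ defined by the average metric equals the classical Pesin pressure of $\varphi$ on $Z$: $$\overline{P}_Z(\varphi)=P_Z(\varphi).$$
   Context: A topological dynamical system $(X,f)$ consists of a compact metric space $(X,d)$ and a continuous map $f:X\to X$. For $n\in\mathbb{N}=\{1,2,\dots\}$ write $S_n\varphi(x)=\sum_{j=0}^{n-1}\varphi(f^jx)$, $d_n(x,y)=\max_{0\le j\le n-1}d(f^jx,f^jy)$, and define the average metric $$\overline{d}_n(x,y)=\frac1n\sum_{i=0}^{n-1}d(f^ix,f^iy).$$ The Bowen ball is $B_n(x,\epsilon)=\{y\in X:d_n(x,y)<\epsilon\}$ and the average dynamical ball is $B_{\overline{d}_n}(x,\epsilon)=\{y\in X:\overline{d}_n(x,y)<\epsilon\}$. Classical Pesin pressure: for $Z\subset X$, $\delta>0$, $N\in\mathbb{N}$, let $\mathcal{P}(Z,N,\delta)$ be the collection of all countable (possibly finite) sets $\{(x_i,n_i)\}\subset Z\times\{N,N+1,\dots\}$ such that $Z\subset\bigcup_iB_{n_i}(x_i,\delta)$. For $s\in\mathbb{R}$ put $$m(Z,s,\varphi,N,\delta)=\inf_{\mathcal{P}(Z,N,\delta)}\sum_{(x_i,n_i)}\exp(-n_is+S_{n_i}\varphi(x_i)),\qquad m(Z,s,\varphi,\delta)=\lim_{N\to\infty}m(Z,s,\varphi,N,\delta).$$ The function $s\mapsto m(Z,s,\varphi,\delta)$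 is non-increasing and takes the values $\infty$ and $0$ at all but at most one $s$; its critical value is $$P_Z(\varphi,\delta)=\inf\{s\in\mathbb{R}:m(Z,s,\varphi,\delta)=0\}=\sup\{s\in\mathbb{R}:m(Z,s,\varphi,\delta)=\infty\}$$ (an extended real number), and $P_Z(\varphi)=\lim_{\delta\to0}P_Z(\varphi,\delta)$. Pesin pressure defined by the average metric: $\overline{P}_Z(\varphi)$ is defined in exactly the same way, with every Bowen ball $B_{n_i}(x_i,\delta)$ in the definition of $\mathcal{P}(Z,N,\delta)$ replaced by the average dynamical ball $B_{\overline{d}_{n_i}}(x_i,\delta)$; that is, the infimum is over countable sets $\{(x_i,n_i)\}\subset Z\times\{N,N+1,\dots\}$ with $Z\subset\bigcup_iB_{\overline{d}_{n_i}}(x_i,\delta)$, one lets $N\to\infty$, takes the critical value $\overline{P}_Z(\varphi,\delta)$ in $s$, and sets $\overline{P}_Z(\varphi)=\lim_{\delta\to0}\overline{P}_Z(\varphi,\delta)$. *)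

(* Defs.v *)
From HB Require Import structures.
From mathcomp Require Import all_boot all_order all_algebra.
From mathcomp Require Import all_classical all_reals all_analysis.

Set Implicit Arguments.
Unset Strict Implicit.
Unset Printing Implicit Defensive.

Import Order.TTheory GRing.Theory Num.Theory.
Import numFieldNormedType.Exports.

Local Open Scope classical_set_scope.
Local Open Scope ring_scope.

Section dynamics.
Context {R : realType} {X : metricType R}.
Implicit Types (f : X -> X) (phi : X -> R) (Z : set X) (n N : nat).

Definition birkhoff_sum f phi n (x : X) : R :=
  \sum_(0 <= j < n) phi (iter j f x).

(* Distances are nonnegative, so starting the maximum at 0 is harmless. *)
Definition bowen_dist f n (x y : X) : R :=
  \big[Num.max/0]_(0 <= j < n) mdist (iter j f x) (iter j f y).

Definition avg_dist f n (x y : X) : R :=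
  n%:R^-1 * \sum_(0 <= i < n) mdist (iter i f x) (iter i f y).

Definition bowen_ball f n (x : X) (e : R) : set X :=
  [set y | bowen_dist f n x y < e].

Definition avg_ball f n (x : X) (e : R) : set X :=
  [set y | avg_dist f n x y < e].

(* The Caratheodory-Pesin construction, for an arbitrary family of balls
   [B n x e]; both pressures below are instances of it. *)

(* Countable includes finite and empty. The value N = 0 is allowed by the type
   but plays no role, since only the limit N -> oo is used. *)
Definition pesin_covers (B : nat -> X -> R -> set X) Z N (delta : R)
    : set (set (X * nat)) :=
  [set G | [/\ countable G,
              (forall p, G p -> Z p.1 /\ (N <= p.2)%N) &
              Z `<=` \bigcup_(p in G) B p.2 p.1 delta]].

(* [m(Z, s, phi, N, delta)]; the infimum of the empty set is +oo. *)
Definition pesin_mN (B : nat -> X -> R -> set X) f phi Z (s : R) N (delta : R)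
    : \bar R :=
  ereal_inf
    [set (\esum_(p in G)
            (expR (- (p.2%:R * s) + birkhoff_sum f phi p.2 p.1))%:E)%E
    | G in pesin_covers B Z N delta].

(* Nondecreasing in N, so the limit exists in [\bar R]. *)
Definition pesin_m (B : nat -> X -> R -> set X) f phi Z (s delta : R)
    : \bar R :=
  limn (fun N => pesin_mN B f phi Z s N delta).

Definition pesin_pressure_at (B : nat -> X -> R -> set X) f phi Z (delta : R)
    : \bar R :=
  ereal_inf [set s%:E | s in [set s : R | pesin_m B f phi Z s delta = 0%E]].

(* When [B n x e] is nondecreasing in e, [pesin_pressure_at] is nonincreasing
   in delta, so the limit exists in [\bar R]. *)
Definition pesin_pressure_of (B : nat -> X -> R -> set X) f phi Z : \bar R :=
  lim (pesin_pressure_at B f phi Z delta @[delta --> 0^'+]).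

Definition pesin_pressure f phi Z : \bar R :=
  pesin_pressure_of (bowen_ball f) f phi Z.

Definition avg_pesin_pressure f phi Z : \bar R :=
  pesin_pressure_of (avg_ball f) f phi Z.

End dynamics.

(* Main.v *)
Require Import Defs.
From mathcomp Require Import all_boot all_order all_algebra.
From mathcomp Require Import all_classical all_reals all_analysis.
From mathcomp Require Import ring lra.
Import Order.TTheory GRing.Theory Num.Theory.
Import numFieldNormedType.Exports.

Local Open Scope classical_set_scope.
Local Open Scope ring_scope.

(* Since the average metric is at most the Bowen metric, only the inequality
   "classical <= average" needs an argument. Fix eps and e, a radius r <= eps / 2
   below the modulus of continuity of phi for e / 2, and a finite r-net; only then
   take d small. A point y of the average d-ball around x has few bad times i < n
   (times at which the orbits of x and y are r-apart). Encode y by the word that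
   is None at good times and a net point r-close to f^i y at bad times: two
   points with the same word lie in a common Bowen eps-ball. Giving each bad time
   the weight exp(-L), the words of length n have total weight
   (1 + K exp(-L))^n, K being the size of the net, whereas each word that occurs
   has weight at least exp(-n e / 2); so at most exp(n e) of them occur. The
   Birkhoff sums at x and y also differ by at most n e. Hence the average
   d-balls of a cover can be refined into Bowen eps-balls at the cost of an
   arbitrarily small shift of s. *)

(** * Sums over unions, compactness, and counting words *)

Lemma esum_bigcup_le (R : realType) (T1 T2 : choiceType) (G : set T1)
    (W : T1 -> set T2) (a : T2 -> \bar R) : (forall q, 0 <= a q)%E ->
  (\esum_(q in \bigcup_(p in G) W p) a q <=
   \esum_(p in G) \esum_(q in W p) a q)%E.
Proof.
move=> a0; rewrite (@esum_esum R T1 T2 G W (fun _ q => a q)); last by [].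
have [->|/set0P[p0 _]] := eqVneq G set0.
  by rewrite bigcup_set0 esum_set0; exact: esum_ge0.
apply: ge_ereal_sup => _ [F [finF FGW] <-].
(* The sets [W p] may overlap; choosing one index [r q] for each [q] embeds the finite set [F] into
   the pairs. Outside [F] the value [p0] is a mere default. *)
have /choice[r rP] : forall q, exists p, F q -> G p /\ W p q.
  move=> q; have [/FGW[p Gp Wpq]|nFq] := pselect (F q); first by exists p.
  by exists p0 => /nFq.
pose h q := (r q, q).
apply: esum_ge; exists (h @` F).
  split; first exact: finite_image.
  by move=> _ [q /rP[Gr Wr] <-].
rewrite (@reindex_fsbig _ _ _ _ _ h F (h @` F))//.
by apply: inj_bij => q q' _ _ [].
Qed.

Lemma esum_seq_le (R : realType) (T : choiceType) (s : seq T) (a : T -> R)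
    (b : R) : (forall q, 0 <= a q) -> (forall q, q \in s -> a q <= b) -> 0 <= b ->
  (\esum_(q in [set` s]) (a q)%:E <= ((size s)%:R * b)%:E)%E.
Proof.
move=> a0 ab b0.
rewrite esum_fset; [|exact: finite_seq|by move=> q _; rewrite lee_fin].
rewrite (_ : [set` s] = [set` undup s]); last first.
  by apply/seteqP; split => q /=; rewrite mem_undup.
rewrite -fsbig_seq ?undup_uniq// sumEFin lee_fin.
rewrite (@le_trans _ _ (\sum_(q <- undup s) b))//.
  rewrite big_seq [leRHS]big_seq.
  by apply: ler_sum => q; rewrite mem_undup => /ab.
rewrite big_const_seq count_predT iter_addr_0 -[leLHS]mulr_natl.
by rewrite ler_pM ?ler_nat ?size_undup.
Qed.

Lemma compact_finite_net (R : realType) (X : metricType R) (e : R) :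
  compact [set: X] -> 0 < e ->
  exists s : seq X, forall y, exists2 c, c \in s & mdist c y < e.
Proof.
move=> /compact_near_coveringP cX e0.
(* The filter of properties shared by all extensions of some list: near-covering along it turns
   local lists into one that serves every point. *)
pose F : set_system (seq X) :=
  [set P | exists s : seq X, forall t : seq X, {subset s <= t} -> P t].
have FF : Filter F.
  split.
  - by exists [::].
  - move=> P Q [s Ps] [t Qt]; exists (s ++ t) => u stu; split.
      by apply: Ps => x xs; apply: stu; rewrite mem_cat xs.
    by apply: Qt => x xs; apply: stu; rewrite mem_cat xs orbT.
  - by move=> P Q PQ [s Ps]; exists s => t /Ps /PQ.
have [|s sP] := cX (seq X) F (fun (t : seq X) y => exists2 c, c \in t & mdist c y < e) FF.
  move=> x _; exists ([set y | mdist x y < e], [set t : seq X | x \in t]) => /=.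
    split; first by rewrite -ballEmdist; exact: nbhsx_ballx.
    by exists [:: x] => t; apply; rewrite inE.
  by move=> [y t] /= [xy xt]; exists x.
by exists s => y; apply: (sP s).
Qed.

Lemma compact_unif_continuous (R : realType) (X : metricType R) (phi : X -> R)
    (e : R) : compact [set: X] -> continuous phi -> 0 < e ->
  exists2 d : R, 0 < d &
    forall x y, mdist x y < d -> `|phi x - phi y| < e.
Proof.
move=> /compact_near_coveringP cX cphi e0.
have : \forall d \near 0^'+, [set: X] `<=`
    (fun y => forall z, mdist y z < d -> `|phi y - phi z| < e).
  apply: cX => x _.
  have /nbhs_ballP[r /= r0 rP] : \forall y \near x, `|phi x - phi y| < e / 2.
    by have /cvgrPdist_lt/(_ (e / 2)) := cphi x; apply; rewrite divr_gt0.
  exists ([set y | mdist x y < r / 2], [set d | d < r / 2]) => /=.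
    split; first by rewrite -ballEmdist; apply: nbhsx_ballx; rewrite divr_gt0.
    by apply: nbhs_right_lt; rewrite divr_gt0.
  move=> [y d] /= [xy dr] z yz.
  have xz : mdist x z < r.
    by rewrite (le_lt_trans (metric_triangle x y z))//; lra.
  have xy' : mdist x y < r by lra.
  move: rP; rewrite ballEmdist => rP.
  have := rP _ xz; have := rP _ xy'; rewrite /= => h1 h2.
  have -> : phi y - phi z = (phi x - phi z) - (phi x - phi y) by lra.
  by rewrite (le_lt_trans (ler_normB _ _))//; lra.
move=> dP; near (0:R)^'+ => d.
exists d; first by [].
by move=> x y; apply: (near dP d).
Unshelve. all: by end_near. Qed.

Lemma compact_continuous_bounded (R : realType) (X : metricType R) (phi : X -> R) :
  compact [set: X] -> continuous phi -> exists2 B : R, 0 <= B & forall x, `|phi x| <= B.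
Proof.
move=> cX cphi.
have : compact (phi @` [set: X]).
  by apply: continuous_compact => //; exact: continuous_subspaceT.
move=> /compact_bounded [M [_ MP]].
exists (`|M| + 1); first by rewrite addr_ge0.
move=> x; apply: (MP (`|M| + 1)); last by exists x.
by rewrite (le_lt_trans (ler_norm _))// ltrDl.
Qed.

(** Expanding the power letter by letter, each position contributes 1 for [None] and [t] for each
    element of [K]. *)
Lemma sum_words (R : comPzSemiRingType) (K : finType) n (t : R) :
  \sum_(w : {ffun 'I_n -> option K}) \prod_i (if w i then t else 1) =
  (1 + #|K|%:R * t) ^+ n.
Proof.
rewrite -(bigA_distr_bigA (fun _ (o : option K) => if o then t else 1)).
rewrite prodr_const card_ord; congr (_ ^+ _).
rewrite (bigD1 None)//=; congr (_ + _).
rewrite (reindex_omap Some id) /=; last by case.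
rewrite (eq_bigl predT); last by move=> x; rewrite /= eqxx.
by rewrite sumr_const mulr_natl.
Qed.

(** * Splitting an average ball into few Bowen balls *)

Section avg_ball_cover.
Context {R : realType} {X : metricType R}.
Implicit Types (f : X -> X) (phi : X -> R) (Z : set X).

Lemma avg_dist_le_bowen_dist f n (x y : X) :
  avg_dist f n x y <= bowen_dist f n x y.
Proof.
rewrite /avg_dist; have [->|n0] := posnP n.
  by rewrite invr0 mul0r /bowen_dist big_nil.
rewrite mulrC ler_pdivrMr ?ltr0n// mulr_natr.
rewrite -[X in _ *+ X]card_ord -sumr_const /bowen_dist !big_mkord.
by apply: ler_sum => i _; exact: le_bigmax.
Qed.

Lemma avg_ball_sum_le f n (x y : X) d : avg_ball f n x d y ->
  \sum_(i < n) mdist (iter i f x) (iter i f y) <= n%:R * d.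
Proof.
rewrite /avg_ball /= /avg_dist; have [->|n0] := posnP n.
  by rewrite big_ord0 mul0r.
by rewrite mulrC ltr_pdivrMr ?ltr0n// big_mkord mulrC => /ltW.
Qed.

(** The radius [d] precedes [Z], [n] and [x], so that it serves all pairs of a cover at once; the
    new centres lie in [Z], as covers demand. *)
Lemma avg_ball_cover f phi (eps e : R) :
  compact [set: X] -> continuous phi -> 0 < eps -> 0 < e ->
  exists2 d : R, 0 < d & forall Z n x, exists s : seq X,
    [/\ forall z, z \in s ->
          Z z /\ birkhoff_sum f phi n z <= birkhoff_sum f phi n x + n%:R * e,
        Z `&` avg_ball f n x d `<=` \bigcup_(z in [set` s]) bowen_ball f n z eps &
        (size s)%:R <= expR (n%:R * e)].
Proof.
move=> cX cphi eps0 e0; pose h : R := e / 2; have h0 : 0 < h by rewrite divr_gt0.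
have [r1 r10 r1P] := compact_unif_continuous _ _ _ _ cX cphi h0.
pose r : R := Num.min r1 (eps / 2).
have r0 : 0 < r by rewrite lt_min r10 divr_gt0.
have [B B0 BP] := compact_continuous_bounded _ _ _ cX cphi.
have [net netP] := compact_finite_net _ _ _ cX r0.
pose K : finType := seq_sub net.
have /choice[c cP] : forall y, exists k : K, mdist (val k) y < r.
  by move=> y; have [k ks ky] := netP y; exists (SeqSub ks).
(* Since [expR L >= L], this gives [#|K| * expR (- L) <= h], so a single letter has total weight at
   most [1 + h <= expR h]. *)
pose L : R := #|K|%:R / h.
have L0 : 0 <= L by rewrite divr_ge0// ltW.
have C0 : 0 < L + B * 2 + 1 by rewrite ltr_wpDl// addr_ge0// mulr_ge0.
(* Makes [M / r * d <= h] for both costs [M] of a bad time used below: [L] for the weights, [B * 2]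
   for the Birkhoff sums. The 1 keeps the denominator positive. *)
pose d : R := r * h / (L + B * 2 + 1).
have d0 : 0 < d by rewrite divr_gt0// mulr_gt0.
exists d => // Z n x.
pose dist y (i : 'I_n) := mdist (iter i f x) (iter i f y).
have dist_ge0 y i : 0 <= dist y i by exact: mdist_ge0.
(* Markov's inequality in summed form: [M / r * dist y i] is at least [M] at every bad time. *)
have sum_dist y (M : R) : avg_ball f n x d y -> 0 <= M <= L + B * 2 ->
    \sum_i M / r * dist y i <= n%:R * h.
  move=> /avg_ball_sum_le yd /andP[M0 MC]; rewrite -mulr_sumr.
  rewrite (@le_trans _ _ (M / r * (n%:R * d)))//.
    by rewrite ler_wpM2l// divr_ge0// ltW.
  rewrite [leLHS](_ : _ = n%:R * h * (M / (L + B * 2 + 1))).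
    apply: ler_piMr; first by rewrite mulr_ge0// ltW.
    by rewrite ler_pdivrMr// mul1r (le_trans MC)// lerDl.
  by rewrite /d; field; rewrite !gt_eqF.
pose word y : {ffun 'I_n -> option K} :=
  [ffun i : 'I_n => if dist y i < r then None else Some (c (iter i f y))].
have word_bowen y z : word y = word z -> bowen_ball f n z eps y.
  move=> wyz; rewrite /bowen_ball/= /bowen_dist big_mkord.
  apply/bigmax_ltP; split=> // i _.
  have r2 : r <= eps / 2 by rewrite ge_min lexx orbT.
  have := congr1 (fun w : {ffun 'I_n -> option K} => w i) wyz; rewrite !ffunE.
  (* Equal letters are both [None], with the orbit of [x] as intermediate point, or name the same
     net point, which then takes that role; either way the distance is below [2 * r <= eps]. *)
  case: ifPn => yr; case: ifPn => zr //.
    have := metric_triangle (iter i f z) (iter i f x) (iter i f y).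
    move: yr zr; rewrite /dist (metric_sym _ (iter i f z)); lra.
  move=> [cyz].
  have := metric_triangle (iter i f z) (val (c (iter i f y))) (iter i f y).
  have := cP (iter i f y); have := cP (iter i f z).
  rewrite -cyz (metric_sym (iter i f z) (val _)); lra.
pose good w := exists y, [/\ Z y, avg_ball f n x d y & word y = w].
have /choice[rep repP] : forall w, exists y, good w ->
    [/\ Z y, avg_ball f n x d y & word y = w].
  by move=> w; have [[y yP]|ng] := pselect (good w); [exists y|exists x => /ng].
pose A := [set w | `[< good w >]]%SET.
exists [seq rep w | w <- enum A]; split.
- move=> z /mapP[w]; rewrite mem_enum inE => /asboolP/repP[Zy yd _] ->.
  split=> //; move: (rep w) yd => y yd.
  rewrite /birkhoff_sum !big_mkord.
  (* One [h] per time pays for the oscillation of [phi] at good times; the other [n * h] pays for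
     the jumps of at most [B * 2] at bad times. *)
  have -> : n%:R * e = \sum_(i < n) h + n%:R * h.
    by rewrite sumr_const card_ord -mulr_natl /h; lra.
  rewrite addrA -big_split/=.
  have := sum_dist y (B * 2) yd; rewrite mulr_ge0// lerDr L0 => /(_ isT).
  rewrite -(lerD2l (\sum_(i < n) (phi (iter i f x) + h))); apply: le_trans.
  rewrite -big_split/=; apply: ler_sum => i _.
  have [xr|rx] := ltP (dist y i) r.
    have := r1P _ _ (lt_le_trans xr _); rewrite ge_min lexx => /(_ isT).
    rewrite ltr_norml => /andP[? ?].
    have : 0 <= B * 2 / r * dist y i by rewrite mulr_ge0// divr_ge0// ?mulr_ge0// ltW.
    lra.
  have : B * 2 <= B * 2 / r * dist y i.
    by rewrite mulrAC ler_pdivlMr// ler_wpM2l// mulr_ge0.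
  have := BP (iter i f x); have := BP (iter i f y).
  rewrite !ler_norml => /andP[? ?] /andP[? ?]; lra.
- move=> y [Zy yd]; have gy : good (word y) by exists y.
  exists (rep (word y)) => /=.
    by apply: map_f; rewrite mem_enum inE; apply/asboolP.
  by apply: word_bowen; have [_ _ ->] := repP _ gy.
rewrite size_map -cardE.
(* One factor [expR (n * h)] bounds the total weight of all words, the other the inverse weight of a
   word in [A]. *)
have -> : n%:R * e = n%:R * h + n%:R * h by rewrite /h; lra.
rewrite expRD -ler_pdivrMr ?expR_gt0// -expRN -mulr_natl mulr1.
have wt_ge w : w \in A ->
    expR (- (n%:R * h)) <= \prod_i (if w i then expR (- L) else 1).
  rewrite inE => /asboolP/repP[_ yd <-]; move: (rep w) yd => y yd.
  rewrite (@le_trans _ _ (\prod_i expR (- (L / r * dist y i))))//.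
    rewrite -expR_sum ler_expR sumrN lerN2 sum_dist// L0 lerDl.
    by rewrite mulr_ge0.
  apply: ler_prod => i _; rewrite expR_ge0/= ffunE.
  have [xr|rx] /= := ltP (dist y i) r.
    by rewrite -expR0 ler_expR oppr_le0 mulr_ge0// divr_ge0// ltW.
  by rewrite ler_expR lerN2 mulrAC ler_pdivlMr// ler_wpM2l.
apply: (@le_trans _ _ (\sum_(w in A) \prod_i (if w i then expR (- L) else 1))).
  by rewrite [leLHS]mulr_natl -sumr_const; apply: ler_sum => w; exact: wt_ge.
apply: (@le_trans _ _ (\sum_(w : {ffun 'I_n -> option K})
    \prod_i (if w i then expR (- L) else 1))).
  rewrite [leRHS](bigID (mem A))/= lerDl; apply: sumr_ge0 => w _.
  by apply: prodr_ge0 => i _; case: ifP => // _; exact: expR_ge0.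
rewrite sum_words expRM_natl lerXn2r ?nnegrE ?addr_ge0 ?mulr_ge0 ?expR_ge0//.
apply: le_trans (expR_ge1Dx h); rewrite lerD2l expRN ler_pdivrMr ?expR_gt0//.
rewrite mulrC -ler_pdivrMr// -/L; apply: le_trans (expR_ge1Dx L).
by rewrite lerDr.
Qed.

End avg_ball_cover.

(** * From covers to pressures *)

Section pesin_pressure_comparison.
Context {R : realType} {X : metricType R}.
Implicit Types (f : X -> X) (phi : X -> R) (Z : set X).
Implicit Types B : nat -> X -> R -> set X.

Lemma pesin_mN_ge0 B f phi Z s N d : (0 <= pesin_mN B f phi Z s N d)%E.
Proof.
apply: le_ereal_inf_tmp => _ [G _ <-].
by apply: esum_ge0 => p _; rewrite lee_fin expR_ge0.
Qed.

Lemma pesin_mN_homo B f phi Z s d :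
  {homo (fun N => pesin_mN B f phi Z s N d) : N M / (N <= M)%N >-> (N <= M)%E}.
Proof.
move=> N M NM; apply: le_ereal_inf => _ [G [cG GM GZ] <-]; exists G => //.
by split=> // p /GM[Zp Mp]; split=> //; exact: leq_trans Mp.
Qed.

(** If [pesin_m] for [B'] vanishes at [s], the one for [B] vanishes at [s + c]. *)
Lemma le_pesin_pressure_at B B' f phi Z d d' (c : R) :
  (forall s N,
    (pesin_mN B f phi Z (s + c) N d <= pesin_mN B' f phi Z s N d')%E) ->
  (pesin_pressure_at B f phi Z d <= pesin_pressure_at B' f phi Z d' + c%:E)%E.
Proof.
move=> BB'; rewrite -leeBlDr//; apply: le_ereal_inf_tmp => _ [s /= ms0 <-].
rewrite EFinN leeBlDr// -EFinD; apply: ereal_inf_lbound; exists (s + c) => //=.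
have cvgm B0 s0 d0 : cvgn (fun N => pesin_mN B0 f phi Z s0 N d0).
  exact/ereal_nondecreasing_is_cvgn/pesin_mN_homo.
apply/eqP; rewrite eq_le; apply/andP; split; last first.
  by apply: lime_ge => //; apply: nearW => N; exact: pesin_mN_ge0.
by rewrite -ms0; apply: lee_lim => //; apply: nearW => N; exact: BB'.
Qed.

Lemma le_pesin_pressure_at_ball B B' f phi Z d d' :
  (forall n x, B' n x d' `<=` B n x d) ->
  (pesin_pressure_at B f phi Z d <= pesin_pressure_at B' f phi Z d')%E.
Proof.
move=> B'B; rewrite -[leRHS]adde0; apply: le_pesin_pressure_at => s N.
rewrite addr0; apply: le_ereal_inf => _ [G [cG GN GZ] <-]; exists G => //.
by split=> //; apply: subset_trans GZ _ => x [p Gp] /B'B; exists p.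
Qed.

(** Larger balls admit more covers, so the limit at [0^'+] is monotone; as suprema, the pressures
    can be compared radius by radius. *)
Lemma pesin_pressure_ofE B f phi Z :
  (forall n x d d', d <= d' -> B n x d `<=` B n x d') ->
  pesin_pressure_of B f phi Z =
  ereal_sup [set pesin_pressure_at B f phi Z d | d in [set d | 0 < d]].
Proof.
move=> Bd; apply/cvg_lim => //.
rewrite (_ : [set d | 0 < d] = [set` `]0, +oo[ ]); last first.
  by apply/seteqP; split => d /=; rewrite in_itv/= andbT.
apply: nonincreasing_at_right_cvge => // d d' _ _ dd'.
by apply: le_pesin_pressure_at_ball => n x; exact: Bd.
Qed.

Lemma bowen_pressure_at_le_avg f phi Z eps e :
  compact [set: X] -> continuous phi -> 0 < eps -> 0 < e ->
  exists2 d : R, 0 < d &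
    (pesin_pressure_at (bowen_ball f) f phi Z eps <=
     pesin_pressure_at (avg_ball f) f phi Z d + e%:E)%E.
Proof.
move=> cX cphi eps0 e0; have h0 : 0 < e / 2 by rewrite divr_gt0.
have [d d0 dP] := avg_ball_cover f phi eps (e / 2) cX cphi eps0 h0.
exists d => //; apply: le_pesin_pressure_at => s N.
apply: le_ereal_inf_tmp => _ [G [cG GN GZ] <-].
have /choice[S SP] := fun p : X * nat => dP Z p.2 p.1.
(* The refined pairs keep the time [p.2], hence still respect the bound [N]. *)
pose W p := [set` [seq (z, p.2) | z <- S p]].
apply: (@le_trans _ _ (\esum_(q in \bigcup_(p in G) W p)
    (expR (- (q.2%:R * (s + e)) + birkhoff_sum f phi q.2 q.1))%:E)%E).
  apply: ereal_inf_lbound; exists (\bigcup_(p in G) W p) => //; split.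
  - by apply: bigcup_countable => // p _; exact/finite_set_countable/finite_seq.
  - move=> _ [p Gp /mapP[z zS ->]] /=; split; last by have [] := GN _ Gp.
    by have [zP _ _] := SP p; have [] := zP _ zS.
  - move=> y Zy; have [p Gp yp] := GZ _ Zy.
    have [_ /(_ y (conj Zy yp))[z zS yz] _] := SP p.
    by exists (z, p.2) => //; exists p => //; exact: map_f.
apply: le_trans (esum_bigcup_le _ _ _ _ _ _ _) _.
  by move=> q; rewrite lee_fin expR_ge0.
apply: le_esum => p Gp; have [zP _ sizeS] := SP p.
pose b := expR (- (p.2%:R * s) + birkhoff_sum f phi p.2 p.1).
(* Half of the shift [e] absorbs the growth of the Birkhoff sum, the other half the number of
   centres in [S p]. *)
apply: le_trans
  (esum_seq_le _ _ _ _ (expR (- (p.2%:R * (e / 2))) * b) _ _ _) _.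
- by move=> q; exact: expR_ge0.
- move=> _ /mapP[z zS ->] /=; have [_ zx] := zP _ zS.
  by rewrite -expRD ler_expR; lra.
- by rewrite mulr_ge0 ?expR_ge0.
rewrite lee_fin size_map mulrA ler_piMl ?expR_ge0//.
by rewrite expRN ler_pdivrMr ?expR_gt0// mul1r.
Qed.

End pesin_pressure_comparison.

Theorem mainTheorem2 (R : realType) (X : metricType R) (f : X -> X)
    (phi : X -> R) (Z : set X) :
  compact [set: X] -> continuous f -> continuous phi ->
  avg_pesin_pressure f phi Z = pesin_pressure f phi Z.
Proof.
move=> cX _ cphi; rewrite /avg_pesin_pressure /pesin_pressure.
rewrite !pesin_pressure_ofE; last 2 first.
- by move=> n x d d' dd' y; rewrite /bowen_ball/= => /lt_le_trans; exact.
- by move=> n x d d' dd' y; rewrite /avg_ball/= => /lt_le_trans; exact.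
apply/eqP; rewrite eq_le; apply/andP; split; apply: ge_ereal_sup => _ [d /= d0 <-].
  apply: (@le_trans _ _ (pesin_pressure_at (bowen_ball f) f phi Z d)); last first.
    by apply: ereal_sup_ubound; exists d.
  apply: le_pesin_pressure_at_ball => n x y; rewrite /bowen_ball /avg_ball/=.
  exact/le_lt_trans/avg_dist_le_bowen_dist.
(* The radius [d'] found below depends on [e], which the supremum over all radii allows. *)
apply/lee_addgt0Pr => e e0.
have [d' d'0 /le_trans] := bowen_pressure_at_le_avg f phi Z d e cX cphi d0 e0.
by apply; rewrite leeD2r//; apply: ereal_sup_ubound; exists d'.
Qed.
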